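(* Let $\mathfrak M$ be an algebra over a field $k$ with a distinguished character $\eta:\mathfrak M\to k$, let $\mathcal L$ and $\mathcal H$ be bialgebras, let $q:\mathcal L\to\mathfrak M$ be a surjective algebra homomorphism, and let $p:\mathcal L\to\mathcal H$ be a surjective algebra homomorphism which is also a coalgebra homomorphism. If $$(q\otimes p)\circ\Delta_{\mathcal L}:\mathcal L\to\mathfrak M\otimes\mathcal H$$ is an isomorphism of algebras, where $\Delta_{\mathcal L}:\mathcal L\to\mathcal L\otimes\mathcal L$ is the comultiplication of $\mathcal L$, then $\mathcal L\cong\mathfrak M\blacktriangleright\!\!\blacktriangleleft^\sigma\mathcal H$ as bialgebras. In this case, the structure maps $\nabla,\blacktriangledown,\delta,\sigma$ are obtained by $$\Delta_{\mathcal L}(x)=x_{\{1\}}\,x_{\{2\}<-1>}\otimes x_{\{2\}<0>},\qquad \Delta_{\mathcal L}(h)={h_{(1)}}^{\{1\}}\,{h_{(1)}}^{\{2\}}{}_{<-1>}\,{h_{(2)}}^{[0]}\otimes{h_{(1)}}^{\{2\}}{}_{<0>}\,{h_{(2)}}^{[1]}\,h_{(3)}$$ for $x\in\mathfrak M$, $h\in\mathcal H$, where $\mathcal L$ is identified with $\mathfrak M\otimes\mathcal H$ through the isomorphism $(q\otimes p)\circ\Delta_{\mathcal L}$ and $x,h$ stand for $x\otimes1$, $1\otimes h$.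
   Context: Sweedler notation $\Delta(h)=h_{(1)}\otimes h_{(2)}$ is used, $\varepsilon$ denotes counits, summations are suppressed. A (right) cocycle double cross coproduct pair $(\mathfrak M,\mathcal H)$ consists of an algebra $\mathfrak M$ with a distinguished character (algebra homomorphism) $\eta:\mathfrak M\to k$, a bialgebra $\mathcal H$, and (unital) algebra homomorphisms, for the tensor product algebra structures, $\nabla:\mathfrak M\to\mathcal H\otimes\mathfrak M$, $\nabla(x)=x_{<-1>}\otimes x_{<0>}$; $\ \blacktriangledown:\mathcal H\to\mathcal H\otimes\mathfrak M$, $\blacktriangledown(h)=h^{[0]}\otimes h^{[1]}$; $\ \delta:\mathfrak M\to\mathfrak M\otimes\mathfrak M$, $\delta(x)=x_{\{1\}}\otimes x_{\{2\}}$; $\ \sigma:\mathcal H\to\mathfrak M\otimes\mathfrak M$, $\sigma(h)=h^{\{1\}}\otimes h^{\{2\}}$, such that for all $x\in\mathfrak M$, $h\in\mathcal H$: $\varepsilon(x_{<-1>})x_{<0>}=x$; $h^{[0]}\eta(h^{[1]})=h$; $x_{<-1>}\eta(x_{<0>})=\eta(x)1$; $\varepsilon(h^{[0]})h^{[1]}=\varepsilon(h)1$; $\eta(h^{\{1\}})\eta(h^{\{2\}})=\varepsilon(h)$. When $\mathfrak M\otimes\mathcal H$, with the tensor product algebra structure, counit $x\otimes h\mapsto\eta(x)\varepsilon(h)$ and comultiplication $$\Delta(x\otimes h)=\big(x_{\{1\}}{h_{(1)}}^{\{1\}}\otimes x_{\{2\}<-1>}\,{h_{(1)}}^{\{2\}}{}_{<-1>}\,{h_{(2)}}^{[0]}\big)\otimes\big(x_{\{2\}<0>}\,{h_{(1)}}^{\{2\}}{}_{<0>}\,{h_{(2)}}^{[1]}\otimes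 h_{(3)}\big),$$ is a bialgebra, it is denoted $\mathfrak M\blacktriangleright\!\!\blacktriangleleft^\sigma\mathcal H$ and called the (right) cocycle double cross coproduct bialgebra. Iterated indices mean iterated application of the maps, e.g. $x_{\{2\}<-1>}\otimes x_{\{2\}<0>}=\nabla(x_{\{2\}})$.
   Formalization: The formal theorem adds the hypothesis that the distinguished character composed with q equals the counit of L (η∘q = ε_L); without it the claim fails, e.g. for H = k, q = id and η a character of L not related to ε_L by any algebra automorphism. *)

(* Defs.v *)
From HB Require Import structures.
From mathcomp Require Import all_boot all_algebra.
From mathcomp Require Import boolp classical_sets.

Set Implicit Arguments.
Unset Strict Implicit.
Unset Printing Implicit Defensive.

Import GRing.Theory.
Local Open Scope quotient_scope.
Local Open Scope ring_scope.

Reserved Notation "V ⊗ W" (at level 40, left associativity).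
Reserved Notation "\sw_ ( a , b <- t ) E"
  (at level 41, E at level 41, a name, b name, t at level 200, right associativity,
   format "'[' \sw_ ( a ,  b  <-  t ) '/  '  E ']'").

(* A list [:: (v1, w1); ...; (vn, wn)] stands for v1 ⊗ w1 + ... + vn ⊗ wn. *)
Inductive tensor_eq (k : fieldType) (V W : lmodType k) :
    seq (V * W) -> seq (V * W) -> Prop :=
| Teq_refl s : tensor_eq s s
| Teq_sym s t : tensor_eq s t -> tensor_eq t s
| Teq_trans t s u : tensor_eq s t -> tensor_eq t u -> tensor_eq s u
| Teq_cat s s' t t' :
    tensor_eq s s' -> tensor_eq t t' -> tensor_eq (s ++ t) (s' ++ t')
| Teq_catC s t : tensor_eq (s ++ t) (t ++ s)
| Teq_0 w : tensor_eq [:: (0, w)] [::]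
| Teq_Dl v v' w : tensor_eq [:: (v + v', w)] [:: (v, w); (v', w)]
| Teq_Dr v w w' : tensor_eq [:: (v, w + w')] [:: (v, w); (v, w')]
| Teq_Z a v w : tensor_eq [:: (a *: v, w)] [:: (v, a *: w)].

Section TensorType.
Variables (k : fieldType) (V W : lmodType k).

Definition tensor_eqb (s t : seq (V * W)) : bool := `[< tensor_eq s t >].

Fact tensor_eqb_refl : reflexive tensor_eqb.
Proof. by move=> s; apply/asboolP; exact: Teq_refl. Qed.

Fact tensor_eqb_sym : symmetric tensor_eqb.
Proof. by move=> s t; apply/asboolP/asboolP => /Teq_sym. Qed.

Fact tensor_eqb_trans : transitive tensor_eqb.
Proof. by move=> t s u /asboolP st /asboolP tu; apply/asboolP; exact: Teq_trans tu. Qed.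

Definition tensor_equiv : equiv_rel (seq (V * W)) :=
  EquivRel tensor_eqb tensor_eqb_refl tensor_eqb_sym tensor_eqb_trans.

Definition tensor : Type := {eq_quot tensor_equiv}.

HB.instance Definition _ := Choice.on tensor.

Definition tens_pi (s : seq (V * W)) : tensor := \pi_{eq_quot tensor_equiv} s.
Definition tens_repr (t : tensor) : seq (V * W) :=
  repr (t : {eq_quot tensor_equiv}).

Lemma tens_reprK t : tens_pi (tens_repr t) = t.
Proof. exact: reprK. Qed.

Lemma tens_piP s t : tens_pi s = tens_pi t <-> tensor_eq s t.
Proof. by split=> [/eqquotP/asboolP|st] //; apply/eqquotP/asboolP. Qed.

Lemma tens_repr_pi s : tensor_eq (tens_repr (tens_pi s)) s.
Proof. by apply/tens_piP; rewrite tens_reprK. Qed.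

Definition tens_zero : tensor := tens_pi [::].
Definition tens_add (t u : tensor) : tensor := tens_pi (tens_repr t ++ tens_repr u).
Definition lscale_seq (a : k) (s : seq (V * W)) := [seq (a *: p.1, p.2) | p <- s].
Definition tens_scale (a : k) (t : tensor) : tensor :=
  tens_pi (lscale_seq a (tens_repr t)).
Definition tens_opp (t : tensor) : tensor := tens_scale (-1) t.

Lemma lscale_seq_eq a s t :
  tensor_eq s t -> tensor_eq (lscale_seq a s) (lscale_seq a t).
Proof.
elim=> [u|u v _|v u w _ uv _ vw|u u' v v' _ uu' _ vv'|u v|w|v v' w|v w w'|b v w].
- exact: Teq_refl.
- exact: Teq_sym.
- exact: Teq_trans vw.
- by rewrite /lscale_seq !map_cat; exact: Teq_cat.
- by rewrite /lscale_seq !map_cat; exact: Teq_catC.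
- by rewrite /= scaler0; exact: Teq_0.
- by rewrite /= scalerDr; exact: Teq_Dl.
- exact: Teq_Dr.
- by rewrite /= scalerA mulrC -scalerA; exact: Teq_Z.
Qed.

Lemma tens_pi_cat s t : tens_pi (s ++ t) = tens_add (tens_pi s) (tens_pi t).
Proof. by apply/tens_piP/Teq_sym/Teq_cat; exact: tens_repr_pi. Qed.

Lemma tens_scale_pi a s : tens_scale a (tens_pi s) = tens_pi (lscale_seq a s).
Proof. by apply/tens_piP/lscale_seq_eq/tens_repr_pi. Qed.

Lemma tens_addA : associative tens_add.
Proof.
move=> t u v; rewrite -[t]tens_reprK -[u]tens_reprK -[v]tens_reprK.
by rewrite -!tens_pi_cat catA.
Qed.

Lemma tens_addC : commutative tens_add.
Proof. by move=> t u; apply/tens_piP/Teq_catC. Qed.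

Lemma tens_add0 : left_id tens_zero tens_add.
Proof.
by move=> t; rewrite -[t]tens_reprK /tens_zero -tens_pi_cat.
Qed.

Lemma tens_pi_ind (P : tensor -> Prop) :
  P tens_zero ->
  (forall v w t, P t -> P (tens_add (tens_pi [:: (v, w)]) t)) ->
  forall t, P t.
Proof.
move=> P0 PS t; rewrite -[t]tens_reprK; elim: (tens_repr t) => [//|[v w] s IHs].
by rewrite -cat1s tens_pi_cat; exact: PS.
Qed.

Lemma tens_scaleDr a : {morph tens_scale a : t u / tens_add t u}.
Proof.
move=> t u; rewrite -[t]tens_reprK -[u]tens_reprK -tens_pi_cat !tens_scale_pi.
by rewrite /lscale_seq map_cat tens_pi_cat.
Qed.

Lemma tens_scaleDl t :
  {morph tens_scale^~ t : a b / a + b >-> tens_add a b}.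
Proof.
move=> a b; elim/tens_pi_ind: t => [|v w t IHt].
  by rewrite !tens_scale_pi -tens_pi_cat.
rewrite !tens_scaleDr IHt !tens_scale_pi /=.
have -> : tens_pi [:: ((a + b) *: v, w)] =
  tens_add (tens_pi [:: (a *: v, w)]) (tens_pi [:: (b *: v, w)]).
  by rewrite -tens_pi_cat; apply/tens_piP; rewrite scalerDl; exact: Teq_Dl.
rewrite -!tens_addA; congr tens_add.
by rewrite !tens_addA; congr tens_add; exact: tens_addC.
Qed.

Lemma tens_scaleA a b t : tens_scale a (tens_scale b t) = tens_scale (a * b) t.
Proof.
rewrite -[t]tens_reprK !tens_scale_pi; congr tens_pi.
by rewrite /lscale_seq -map_comp; apply: eq_map => p /=; rewrite scalerA.
Qed.

Lemma tens_scale1 : left_id 1 tens_scale.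
Proof.
move=> t; rewrite -[t]tens_reprK !tens_scale_pi; congr tens_pi.
by rewrite -[RHS]map_id; apply: eq_map => -[v w] /=; rewrite scale1r.
Qed.

Lemma tens_scale0 t : tens_scale 0 t = tens_zero.
Proof.
elim/tens_pi_ind: t => [|v w t IHt]; first by rewrite tens_scale_pi.
rewrite tens_scaleDr IHt tens_scale_pi /= scale0r tens_addC tens_add0.
by apply/tens_piP/Teq_0.
Qed.

Lemma tens_addN : left_inverse tens_zero tens_opp tens_add.
Proof.
by move=> t; rewrite -[X in tens_add _ X]tens_scale1 -tens_scaleDl addNr tens_scale0.
Qed.

HB.instance Definition _ :=
  GRing.isZmodule.Build tensor tens_addA tens_addC tens_add0 tens_addN.
HB.instance Definition _ := GRing.Zmodule_isLmodule.Build k tensor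
  tens_scaleA tens_scale1 tens_scaleDr tens_scaleDl.

Definition ptensor (v : V) (w : W) : tensor := tens_pi [:: (v, w)].

End TensorType.

Arguments tensor {k} (V W)%_type_scope.
Notation "V ⊗ W" := (tensor V W) : type_scope.
Notation "v ⊗ w" := (ptensor v w) : ring_scope.

(* Sweedler sum: [\sw_(a, b <- t) f a b] is the sum of the [f a b] over a chosen
   expression of [t] as a sum of pure tensors [a ⊗ b].  When [f] is bilinear it
   does not depend on that expression (lemma [sw_pure]). *)
Definition sw (k : fieldType) (V W : lmodType k) (X : nmodType)
  (t : V ⊗ W) (f : V -> W -> X) : X := \sum_(p <- tens_repr t) f p.1 p.2.

Notation "\sw_ ( a , b <- t ) E" := (sw t (fun a b => E)) : ring_scope.

Section TensorTheory.
Variables (k : fieldType) (V W : lmodType k).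

Lemma ptensor_bilinear : bilinear_for *:%R *:%R (@ptensor k V W).
Proof.
have scl a (v : V) (w : W) : (a *: v) ⊗ w = a *: (v ⊗ w).
  by apply: esym; exact: tens_scale_pi.
have scr a (v : V) (w : W) : v ⊗ (a *: w) = a *: (v ⊗ w).
  by rewrite -scl; apply/tens_piP/Teq_sym/Teq_Z.
split=> [w a v v'|v a w w'] /=.
  rewrite -scl; transitivity (tens_pi ([:: (a *: v, w)] ++ [:: (v', w)])).
    by apply/tens_piP/Teq_Dl.
  exact: tens_pi_cat.
rewrite -scr; transitivity (tens_pi ([:: (v, a *: w)] ++ [:: (v, w')])).
  by apply/tens_piP/Teq_Dr.
exact: tens_pi_cat.
Qed.

Lemma ptensorDl (v v' : V) (w : W) : (v + v') ⊗ w = v ⊗ w + v' ⊗ w.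
Proof. by have := ptensor_bilinear.1 w 1 v v'; rewrite /= !scale1r. Qed.
Lemma ptensorDr (v : V) (w w' : W) : v ⊗ (w + w') = v ⊗ w + v ⊗ w'.
Proof. by have := ptensor_bilinear.2 v 1 w w'; rewrite /= !scale1r. Qed.
Lemma ptensor0l (w : W) : (0 : V) ⊗ w = 0.
Proof. by apply: (addIr (0 ⊗ w)); rewrite -ptensorDl !add0r. Qed.
Lemma ptensor0r (v : V) : v ⊗ (0 : W) = 0.
Proof. by apply: (addIr (v ⊗ 0)); rewrite -ptensorDr !add0r. Qed.
Lemma ptensorZl a (v : V) (w : W) : (a *: v) ⊗ w = a *: (v ⊗ w).
Proof. by have := ptensor_bilinear.1 w a v 0; rewrite /= ptensor0l !addr0. Qed.
Lemma ptensorZr a (v : V) (w : W) : v ⊗ (a *: w) = a *: (v ⊗ w).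
Proof. by have := ptensor_bilinear.2 v a w 0; rewrite /= ptensor0r !addr0. Qed.

Lemma tensor_sum (t : V ⊗ W) : t = \sw_(v, w <- t) (v ⊗ w).
Proof.
rewrite /sw -[LHS]tens_reprK; elim: (tens_repr t) => [|[v w] s IHs].
  by rewrite big_nil.
by rewrite big_cons -IHs -cat1s tens_pi_cat.
Qed.

Lemma tensor_ind (P : V ⊗ W -> Prop) :
  (forall v w, P (v ⊗ w)) -> (forall t u, P t -> P u -> P (t + u)) ->
  forall t, P t.
Proof.
move=> P1 PD; apply: tens_pi_ind => [|v w t]; last by apply: PD; exact: P1.
by rewrite [tens_zero _ _](_ : _ = 0 ⊗ 0) // ptensor0l.
Qed.

Variables (X : lmodType k) (f : V -> W -> X).
Hypothesis f_bilin : bilinear_for *:%R *:%R f.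

Lemma bilin_suml s t : tensor_eq s t ->
  \sum_(p <- s) f p.1 p.2 = \sum_(p <- t) f p.1 p.2 :> X.
Proof.
have [fl fr] := f_bilin.
have fDl v v' w : f (v + v') w = f v w + f v' w.
  by have := fl w 1 v v'; rewrite /= !scale1r.
have fDr v w w' : f v (w + w') = f v w + f v w'.
  by have := fr v 1 w w'; rewrite /= !scale1r.
have f0l w : f 0 w = 0 by apply: (addIr (f 0 w)); rewrite -fDl !add0r.
have f0r v : f v 0 = 0 by apply: (addIr (f v 0)); rewrite -fDr !add0r.
elim=> [u|u v _|v u w _ uv _ vw|u u' v v' _ uu' _ vv'|u v|w|v v' w|v w w'|a v w].
- by [].
- by [].
- by rewrite uv.
- by rewrite !big_cat /= uu' vv'.
- by rewrite !big_cat /= addrC.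
- by rewrite big_seq1 big_nil f0l.
- by rewrite big_seq1 !big_cons big_nil addr0 fDl.
- by rewrite big_seq1 !big_cons big_nil addr0 fDr.
- rewrite !big_seq1 /=; have := fl w a v 0; have := fr v a w 0.
  by rewrite /= f0l f0r !addr0 => -> ->.
Qed.

(* With linearity of [sw] this is the universal property of [V ⊗ W]. *)
Lemma sw_pure v w : sw (v ⊗ w) f = f v w.
Proof. by rewrite /sw (bilin_suml (tens_repr_pi _)) big_seq1. Qed.

Lemma swD t u : sw (t + u) f = sw t f + sw u f.
Proof. by rewrite /sw (bilin_suml (tens_repr_pi _)) big_cat. Qed.

Lemma swZ a t : sw (a *: t) f = a *: sw t f.
Proof.
rewrite /sw (bilin_suml (tens_repr_pi _)) /lscale_seq big_map scaler_sumr.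
apply: eq_bigr => -[v w] _ /=; have [fl _] := f_bilin.
have f0l : f 0 w = 0.
  apply: (addIr (f 0 w)); rewrite add0r.
  by have := fl w 1 0 0; rewrite /= !scale1r addr0 => <-.
by have := fl w a v 0; rewrite /= f0l !addr0.
Qed.

Lemma sw_linear : linear (fun t : V ⊗ W => sw t f).
Proof. by move=> a t u; rewrite swD swZ. Qed.

End TensorTheory.

Lemma tensor_lin_ext (k : fieldType) (V W X : lmodType k) (f g : V ⊗ W -> X) :
  linear f -> linear g -> (forall v w, f (v ⊗ w) = g (v ⊗ w)) -> f =1 g.
Proof.
move=> fl gl fg; apply: tensor_ind => // t u ft gu.
have := fl 1 t u; have := gl 1 t u; rewrite !scale1r => -> ->.
by rewrite ft gu.
Qed.

Lemma linear_functional_ex (k : fieldType) (V : lmodType k) (v : V) :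
  v != 0 -> exists2 f : V -> k^o, linear f & f v = 1.
Proof.
move=> vN0.
pose lin (U : set V) := forall a x y, U x -> U y -> U (a *: x + y).
pose P (U : set V) := lin U /\ ~ U v.
have [F FP Ftot|U [[Ulin UNv] Umax]] := @Zorn_bigcup V P.
  split=> [a x y [X FX Xx] [Y FY Yy]|[X /FP[_ XNv] //]].
  have [XY|YX] := Ftot _ _ FX FY.
    by exists Y => //; apply: (FP _ FY).1 => //; exact: XY.
  by exists X => //; apply: (FP _ FX).1 => //; exact: YX.
have U0 : U 0.
  apply: contrapT => UN0; apply: (Umax [set 0]%classic); last first.
    split=> [a x y -> ->|v0]; first by rewrite scaler0 addr0.
    by rewrite [v]v0 eqxx in vN0.
  suff -> : U = set0%classic by split=> [x []|/(_ 0 erefl)].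
  apply/seteqP; split=> // x Ux; apply: UN0.
  by have := Ulin (-1) x x Ux Ux; rewrite scaleN1r addNr.
have UZ a x : U x -> U (a *: x) by move=> Ux; rewrite -[_ *: _]addr0; exact: Ulin.
have dec x : exists c, U (x - c *: v).
  have [Ux|UNx] := pselect (U x); first by exists 0; rewrite scale0r subr0.
  pose B : set V := [set z | exists a, U (z - a *: x)]%classic.
  have UB : (U `<=` B)%classic by move=> z Uz; exists 0; rewrite scale0r subr0.
  have Bx : B x by exists 1; rewrite scale1r subrr.
  have PB : ~ P B.
    by apply: Umax; split=> // BU; apply: UNx; exact: BU.
  have Blin : lin B.
    move=> a y z [b Uy] [c Uz]; exists (a * b + c).
    have := Ulin a _ _ Uy Uz; congr U.
    by rewrite scalerBr scalerDl scalerA opprD addrACA.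
  have [a Uv] : B v by apply: contrapT => BNv; exact: PB.
  have aN0 : a != 0.
    by apply/eqP => a0; apply: UNv; move: Uv; rewrite a0 scale0r subr0.
  exists a^-1; have := UZ (- a^-1) _ Uv; congr U.
  by rewrite scalerBr !scaleNr scalerA mulVf // scale1r opprK addrC.
have uniq_c x c d : U (x - c *: v) -> U (x - d *: v) -> c = d.
  move=> Uc Ud; apply/eqP; apply: contrapT => /negP.
  rewrite -subr_eq0 => cd; apply: UNv.
  have := UZ (c - d)^-1 _ (Ulin (-1) _ _ Uc Ud); congr U.
  rewrite scaleN1r opprB addrA subrK -scalerBl scalerA mulVf ?scale1r //.
have [f fP] := choice dec.
exists (f : V -> k^o); last by apply: (uniq_c v _ _ (fP v)); rewrite scale1r subrr.
move=> a x y; apply: (uniq_c (a *: x + y) _ _ (fP _)).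
have := Ulin a _ _ (fP x) (fP y); congr U.
by rewrite scalerBr scalerA scalerDl opprD addrACA.
Qed.

Section TensorAlg.
Variables (k : fieldType) (A B : algType k).

Definition tens_mul (s t : A ⊗ B) : A ⊗ B :=
  \sw_(a, b <- s) \sw_(a', b' <- t) ((a * a') ⊗ (b * b')).

Fact tens_mul_bilin2 (a : A) (b : B) :
  bilinear_for *:%R *:%R (fun a' b' => (a * a') ⊗ (b * b')).
Proof.
split=> [b' c x y|a' c x y] /=.
  by rewrite mulrDr -scalerAr ptensorDl ptensorZl.
by rewrite mulrDr -scalerAr ptensorDr ptensorZr.
Qed.

Fact tens_mul_bilin1 (t : A ⊗ B) :
  bilinear_for *:%R *:%R
    (fun a b => \sw_(a', b' <- t) ((a * a') ⊗ (b * b'))).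
Proof.
split=> [b c x y|a c x y] /=; rewrite /sw scaler_sumr -big_split /=;
  apply: eq_bigr => p _.
- by rewrite mulrDl -scalerAl ptensorDl ptensorZl.
- by rewrite mulrDl -scalerAl ptensorDr ptensorZr.
Qed.

Lemma tens_mul_pure a b a' b' :
  tens_mul (a ⊗ b) (a' ⊗ b') = (a * a') ⊗ (b * b').
Proof.
rewrite /tens_mul (sw_pure (tens_mul_bilin1 _)).
exact: (sw_pure (tens_mul_bilin2 _ _)).
Qed.

Lemma tens_mulDl : left_distributive tens_mul +%R.
Proof. by move=> s t u; exact: (swD (tens_mul_bilin1 u)). Qed.

Lemma tens_mulDr : right_distributive tens_mul +%R.
Proof.
move=> s t u; rewrite /tens_mul /sw -big_split; apply: eq_bigr => p _ /=.
exact: (swD (tens_mul_bilin2 _ _)).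
Qed.

Lemma tens_mulZl c s t : c *: tens_mul s t = tens_mul (c *: s) t.
Proof. exact/esym/(swZ (tens_mul_bilin1 t)). Qed.

Lemma tens_mulZr c s t : c *: tens_mul s t = tens_mul s (c *: t).
Proof.
rewrite /tens_mul /sw scaler_sumr; apply: eq_bigr => p _ /=.
exact/esym/(swZ (tens_mul_bilin2 _ _)).
Qed.

Lemma tens_mulA : associative tens_mul.
Proof.
move=> s t u; elim/tensor_ind: s => [a b|s s' IH IH']; last first.
  by rewrite !tens_mulDl IH IH'.
elim/tensor_ind: t => [a' b'|t t' IH IH']; last first.
  by rewrite !(tens_mulDl, tens_mulDr) IH IH'.
elim/tensor_ind: u => [a'' b''|u u' IH IH']; last first.
  by rewrite !tens_mulDr IH IH'.
by rewrite !tens_mul_pure !mulrA.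
Qed.

Lemma tens_mul1 : left_id (1 ⊗ 1) tens_mul.
Proof.
elim/tensor_ind => [a b|s s' IH IH']; first by rewrite tens_mul_pure !mul1r.
by rewrite tens_mulDr IH IH'.
Qed.

Lemma tens_1mul : right_id (1 ⊗ 1) tens_mul.
Proof.
elim/tensor_ind => [a b|s s' IH IH']; first by rewrite tens_mul_pure !mulr1.
by rewrite tens_mulDl IH IH'.
Qed.

Lemma tens_1neq0 : (1 ⊗ 1 : A ⊗ B) != 0.
Proof.
have [f flin f1] := linear_functional_ex (oner_neq0 A).
have [g glin g1] := linear_functional_ex (oner_neq0 B).
pose h a b : k^o := f a * g b.
have hbil : bilinear_for *:%R *:%R h.
  split=> [b c x y|a c x y]; rewrite /h /=.
    by rewrite flin mulrDl -scalerAl.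
  by rewrite glin mulrDr -scalerAr.
apply/eqP => /(congr1 (fun t => sw t h)); rewrite (sw_pure hbil).
rewrite -(scale0r (1 ⊗ 1)) (swZ hbil) scale0r /h f1 g1 mulr1 => /eqP.
by rewrite oner_eq0.
Qed.

HB.instance Definition _ := GRing.Zmodule_isNzRing.Build (tensor A B)
  tens_mulA tens_mul1 tens_1mul tens_mulDl tens_mulDr tens_1neq0.
HB.instance Definition _ := GRing.Lmodule_isLalgebra.Build k (tensor A B) tens_mulZl.
HB.instance Definition _ := GRing.Lalgebra_isAlgebra.Build k (tensor A B) tens_mulZr.

Lemma ptensorM (a a' : A) (b b' : B) : (a ⊗ b) * (a' ⊗ b') = (a * a') ⊗ (b * b').
Proof. exact: tens_mul_pure. Qed.

Lemma ptensor1 : (1 : A) ⊗ (1 : B) = 1.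
Proof. by []. Qed.

End TensorAlg.

Definition tens_map (k : fieldType) (V V' W W' : lmodType k)
  (f : V -> V') (g : W -> W') (t : V ⊗ W) : V' ⊗ W' :=
  \sw_(v, w <- t) (f v ⊗ g w).

Definition alg_hom (k : fieldType) (A B : algType k) (f : A -> B) : Prop :=
  linear f /\ monoid_morphism f.

Definition alg_iso (k : fieldType) (A B : algType k) (f : A -> B) : Prop :=
  alg_hom f /\ bijective f.

Definition bialgebra_axioms (k : fieldType) (A : algType k)
    (D : A -> A ⊗ A) (e : A -> k^o) : Prop :=
  [/\ alg_hom D, alg_hom e,
      forall a, \sw_(a12, a3 <- D a) \sw_(a1, a2 <- D a12) (a1 ⊗ (a2 ⊗ a3)) =
                \sw_(a1, a23 <- D a) \sw_(a2, a3 <- D a23) (a1 ⊗ (a2 ⊗ a3)),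
      forall a, \sw_(a1, a2 <- D a) (e a1 *: a2) = a &
      forall a, \sw_(a1, a2 <- D a) (e a2 *: a1) = a].

Definition coalg_hom (k : fieldType) (V W : lmodType k)
    (DV : V -> V ⊗ V) (eV : V -> k^o) (DW : W -> W ⊗ W) (eW : W -> k^o)
    (f : V -> W) : Prop :=
  (forall v, tens_map f f (DV v) = DW (f v)) /\ (forall v, eW (f v) = eV v).

HB.mixin Record isBialgebra (k : fieldType) A of GRing.Algebra k A := {
  comul : A -> tensor A A;
  counit : A -> k^o;
  bialgebraP : bialgebra_axioms comul counit
}.

#[short(type="bialgType")]
HB.structure Definition Bialgebra (k : fieldType) :=
  {A of GRing.Algebra k A & isBialgebra k A}.

Section BialgebraMorphisms.
Variables (k : fieldType) (A : bialgType k).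

Fact comul_alg_hom : alg_hom (@comul k A).
Proof. by have [] := @bialgebraP k A. Qed.
Fact counit_alg_hom : alg_hom (@counit k A).
Proof. by have [] := @bialgebraP k A. Qed.

HB.instance Definition _ :=
  GRing.isLinear.Build k A (tensor A A) *:%R (@comul k A) comul_alg_hom.1.
HB.instance Definition _ :=
  GRing.isMonoidMorphism.Build A (tensor A A) (@comul k A) comul_alg_hom.2.
HB.instance Definition _ :=
  GRing.isLinear.Build k A k^o *:%R (@counit k A) counit_alg_hom.1.
HB.instance Definition _ :=
  GRing.isMonoidMorphism.Build A k^o (@counit k A) counit_alg_hom.2.

End BialgebraMorphisms.

(* The structure maps of a right cocycle double cross coproduct pair:
     [nabla x] = x_<-1> ⊗ x_<0>,   [btri h] = h^[0] ⊗ h^[1],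
     [delta x] = x_{1} ⊗ x_{2},    [sigma h] = h^{1} ⊗ h^{2}. *)
Record cocycle_pair (k : fieldType) (M : algType k) (eta : {lrmorphism M -> k^o})
    (H : bialgType k) := CocyclePair {
  nabla : {lrmorphism M -> H ⊗ M};
  btri : {lrmorphism H -> H ⊗ M};
  delta : {lrmorphism M -> M ⊗ M};
  sigma : {lrmorphism H -> M ⊗ M};
  nabla_counit : forall x, \sw_(xm, x0 <- nabla x) (counit xm *: x0) = x;
  btri_eta : forall h, \sw_(h0, h1 <- btri h) (eta h1 *: h0) = h;
  nabla_eta : forall x, \sw_(xm, x0 <- nabla x) (eta x0 *: xm) = eta x *: 1;
  btri_counit : forall h, \sw_(h0, h1 <- btri h) (counit h0 *: h1) = counit h *: 1;
  sigma_eta : forall h, \sw_(s1, s2 <- sigma h) (eta s1 * eta s2) = counit h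
}.

Section CocycleDoubleCrossCoproduct.
Variables (k : fieldType) (M : algType k) (eta : {lrmorphism M -> k^o}).
Variables (H : bialgType k) (P : cocycle_pair eta H).

Definition ccdc_counit (t : M ⊗ H) : k^o := \sw_(x, h <- t) (eta x * counit h).

(* Linear extension of
   Δ(x ⊗ h) = (x_{1} h_(1)^{1} ⊗ x_{2}<-1> h_(1)^{2}_<-1> h_(2)^[0])
            ⊗ (x_{2}<0> h_(1)^{2}_<0> h_(2)^[1] ⊗ h_(3)). *)
Definition ccdc_comul (t : M ⊗ H) : (M ⊗ H) ⊗ (M ⊗ H) :=
  \sw_(x, h <- t)
  \sw_(x1, x2 <- delta P x) \sw_(x2m, x20 <- nabla P x2)
  \sw_(h12, h3 <- comul h) \sw_(h1, h2 <- comul h12)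
  \sw_(s1, s2 <- sigma P h1) \sw_(s2m, s20 <- nabla P s2)
  \sw_(b0, b1 <- btri P h2)
    ((x1 * s1) ⊗ (x2m * s2m * b0)) ⊗ ((x20 * s20 * b1) ⊗ h3).

(* The formulas for the coproduct of a bialgebra [L] in terms of the structure
   maps, [L] being identified with [M ⊗ H] through [Psi : M ⊗ H -> L]: the
   elements x of [M] and h of [H] stand for [Psi (x ⊗ 1)] and [Psi (1 ⊗ h)]. *)
Definition comul_formulas (L : bialgType k) (Psi : M ⊗ H -> L) : Prop :=
  let m x := Psi (x ⊗ 1) in
  let c h := Psi (1 ⊗ h) in
  (forall x, comul (m x) =
     \sw_(x1, x2 <- delta P x) \sw_(x2m, x20 <- nabla P x2)
       ((m x1 * c x2m) ⊗ m x20)) /\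
  (forall h, comul (c h) =
     \sw_(h12, h3 <- comul h) \sw_(h1, h2 <- comul h12)
     \sw_(s1, s2 <- sigma P h1) \sw_(s2m, s20 <- nabla P s2)
     \sw_(b0, b1 <- btri P h2)
       ((m s1 * c s2m * c b0) ⊗ (m s20 * m b1 * c h3))).

End CocycleDoubleCrossCoproduct.

(* Main.v *)
Require Import Defs.
From HB Require Import structures.
From mathcomp Require Import all_boot all_algebra.
From mathcomp Require Import boolp.

(* Let Psi be the inverse of Phi = (q ⊗ p) Δ, m x = Psi (x ⊗ 1), c h = Psi (1 ⊗ h).
   Applying Psi Phi = id gives l = m (q l_1) c (p l_2) for every l in L.  As Phi is
   right H-colinear, (id ⊗ p) Δ (m x) = m x ⊗ 1 and
   (id ⊗ p) Δ (c h) = c h_1 ⊗ h_2; inserting the factorization of l into the second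
   leg of Δ yields Δ l = l_1 ⊗ m (q l_2) for l = m x, and
   Δ (c h) = l_1 ⊗ m (q l_2) c h_2 with l = c h_1.  Together with coassociativity
   these give the two formulas for the maps
     delta = (q ⊗ q) Δ m,  nabla = (p ⊗ q) Δ m,
     sigma = (q ⊗ q) Δ c,  btri  = (p ⊗ q) Δ c.
   Conversely, applying q ⊗ q and p ⊗ q to the formulas recovers the structure
   maps from Δ.  Since m and c commute, multiplying the formulas for m x and c h
   shows that Psi intertwines the coproduct of M ⊗ H with Δ. *)

Set Implicit Arguments.
Unset Strict Implicit.
Unset Printing Implicit Defensive.

Import GRing.Theory.
Local Open Scope ring_scope.

(** * Linearity of expressions built from tensors, products, scalings and Sweedler sums *)

Section Linearity.
Variable k : fieldType.
Implicit Types U V W X Y : lmodType k.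

Lemma linear_idfun V : linear (fun x : V => x).
Proof. by []. Qed.

Lemma linear_comp U V W (f : V -> W) (g : U -> V) :
  linear f -> linear g -> linear (fun x => f (g x)).
Proof. by move=> fl gl a x y; rewrite gl fl. Qed.

Lemma linear_ptensorl U V W (f : U -> V) (w : W) :
  linear f -> linear (fun x => f x ⊗ w).
Proof. by move=> fl a x y; rewrite fl ptensorDl ptensorZl. Qed.

Lemma linear_ptensorr U V W (v : V) (f : U -> W) :
  linear f -> linear (fun x => v ⊗ f x).
Proof. by move=> fl a x y; rewrite fl ptensorDr ptensorZr. Qed.

Lemma linear_mull U (A : algType k) (f : U -> A) (b : A) :
  linear f -> linear (fun x => f x * b).
Proof. by move=> fl a x y; rewrite fl mulrDl scalerAl. Qed.

Lemma linear_mulr U (A : algType k) (b : A) (f : U -> A) :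
  linear f -> linear (fun x => b * f x).
Proof. by move=> fl a x y; rewrite fl mulrDr scalerAr. Qed.

Lemma linear_scalel U V (f : U -> k^o) (v : V) :
  linear f -> linear (fun x => f x *: v).
Proof. by move=> fl a x y; rewrite fl scalerDl scalerA. Qed.

Lemma linear_scaler U V (c : k) (f : U -> V) :
  linear f -> linear (fun x => c *: f x).
Proof. by move=> fl a x y; rewrite fl scalerDr !scalerA mulrC. Qed.

Lemma linear_swl U V W X (t : U -> V ⊗ W) (f : V -> W -> X) :
  bilinear_for *:%R *:%R f -> linear t -> linear (fun x => sw (t x) f).
Proof. by move=> fb tl a x y; rewrite tl (sw_linear fb). Qed.

Lemma linear_swr U V W X (t : V ⊗ W) (f : U -> V -> W -> X) :
  (forall v w, linear (fun x => f x v w)) -> linear (fun x => sw t (f x)).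
Proof.
move=> fl a x y; rewrite /sw scaler_sumr -big_split.
by apply: eq_bigr => p _; rewrite fl.
Qed.

Lemma linear_bilinl U V W X (F : V -> W -> X) (f : U -> V) (w : W) :
  bilinear_for *:%R *:%R F -> linear f -> linear (fun x => F (f x) w).
Proof. by case=> Fl _; exact: linear_comp (Fl w). Qed.

Lemma linear_bilinr U V W X (F : V -> W -> X) (v : V) (f : U -> W) :
  bilinear_for *:%R *:%R F -> linear f -> linear (fun x => F v (f x)).
Proof. by case=> _ Fr; exact: linear_comp (Fr v). Qed.

(** The content is definitional; the statement only gives both goals the form [linear (fun x => _)]
    that [lin] matches. *)
Lemma bilinear_intro U V X (f : U -> V -> X) :
  (forall v, linear (fun u => f u v)) -> (forall u, linear (fun v => f u v)) ->
  bilinear_for *:%R *:%R f.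
Proof. by []. Qed.

End Linearity.

(* The variable must occur exactly once in the expression: [first] then picks the
   side that contains it. *)
Ltac lin :=
  cbv beta;
  lazymatch goal with
  | |- forall _, _ => intro; lin
  | |- bilinear_for _ _ _ => apply: bilinear_intro; lin
  | |- GRing.linear_for _ (fun x => x) => exact: linear_idfun
  | |- GRing.linear_for _ (fun x => sw (@?t x) (@?f x)) =>
      first [ apply: (@linear_swr _ _ _ _ _ _ f)
            | apply: (@linear_swl _ _ _ _ _ t) ]; lin
  | |- GRing.linear_for _ (fun x => (@?f x) ⊗ (@?g x)) =>
      first [ apply: (@linear_ptensorl _ _ _ _ f)
            | apply: (@linear_ptensorr _ _ _ _ _ g) ]; lin
  | |- GRing.linear_for _ (fun x => (@?f x) * (@?g x)) =>
      first [ apply: (@linear_mull _ _ _ f)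
            | apply: (@linear_mulr _ _ _ _ g) ]; lin
  | |- GRing.linear_for _ (fun x => (@?f x) *: (@?g x)) =>
      first [ apply: (@linear_scalel _ _ _ f)
            | apply: (@linear_scaler _ _ _ _ g) ]; lin
  | Fb : bilinear_for _ _ ?F
    |- GRing.linear_for _ (fun x => ?F (@?f x) (@?g x)) =>
      first [ apply: (@linear_bilinl _ _ _ _ _ F f _ Fb)
            | apply: (@linear_bilinr _ _ _ _ _ F _ g Fb) ]; lin
  | Fb : bilinear_for _ _ ?F |- GRing.linear_for _ (?F ?v) => exact: (Fb.2 v)
  | |- GRing.linear_for _ (fun x => ?f x) =>
      solve [ assumption | exact: linearP ]
  | |- GRing.linear_for _ (fun x => ?f (@?g x)) =>
      apply: (@linear_comp _ _ _ _ f g); lin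
  | |- _ => solve [ assumption | exact: linearP ]
  end.

(** * Calculus of Sweedler sums *)

Section Sweedler.
Variable k : fieldType.
Implicit Types U V W X Y Z : lmodType k.

Lemma eq_sw V W (X : nmodType) (t : V ⊗ W) (f g : V -> W -> X) :
  (forall v w, f v w = g v w) -> sw t f = sw t g.
Proof. by move=> fg; apply: eq_bigr. Qed.

Lemma linear_homog X Y (h : X -> Y) (a : k) (x : X) :
  linear h -> h (a *: x) = a *: h x.
Proof.
move=> hl; have h0 : h 0 = 0.
  by have := hl (-1) 0 0; rewrite scaleN1r addr0 oppr0 scaleN1r addNr.
by have := hl a x 0; rewrite h0 !addr0.
Qed.

(** [sw t f] is a finite sum over one fixed representative of [t], so [h] passes through it for
    arbitrary [f]. *)
Lemma linear_sw V W X Y (h : X -> Y) (t : V ⊗ W) (f : V -> W -> X) :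
  linear h -> h (sw t f) = \sw_(v, w <- t) h (f v w).
Proof.
move=> hl; rewrite /sw; apply: (big_morph h) => [x y|].
  by have := hl 1 x y; rewrite !scale1r.
by rewrite -(scale0r 0) linear_homog // !scale0r.
Qed.

Lemma sw_sw U V W X Y (t : U ⊗ V) (g : U -> V -> W ⊗ X) (f : W -> X -> Y) :
  bilinear_for *:%R *:%R f ->
  sw (sw t g) f = \sw_(u, v <- t) sw (g u v) f.
Proof.
move=> fb; rewrite (linear_sw (h := fun s => sw s f)) //.
exact: sw_linear.
Qed.

Lemma sw_map U V W X Y (f : U -> W) (g : V -> X) (t : U ⊗ V) (h : W -> X -> Y) :
  bilinear_for *:%R *:%R h ->
  sw (tens_map f g t) h = \sw_(u, v <- t) h (f u) (g v).
Proof. by move=> hb; rewrite sw_sw //; apply: eq_sw => u v; rewrite sw_pure. Qed.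

Lemma mul_sw U V W X (A : algType k) (s : U ⊗ V) (t : W ⊗ X)
    (f : U -> V -> A) (g : W -> X -> A) :
  sw s f * sw t g = \sw_(u, v <- s) \sw_(w, x <- t) (f u v * g w x).
Proof. by rewrite /sw mulr_suml; apply: eq_bigr => p _; rewrite mulr_sumr. Qed.

Lemma sw_mull U V (A : algType k) (s : U ⊗ V) (f : U -> V -> A) (a : A) :
  sw s f * a = \sw_(u, v <- s) (f u v * a).
Proof. exact: mulr_suml. Qed.

Lemma sw_mulr U V (A : algType k) (s : U ⊗ V) (f : U -> V -> A) (a : A) :
  a * sw s f = \sw_(u, v <- s) (a * f u v).
Proof. exact: mulr_sumr. Qed.

Lemma sw_prod (A B : algType k) X (s t : A ⊗ B) (F : A -> B -> X) :
  bilinear_for *:%R *:%R F ->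
  sw (s * t) F = \sw_(a, b <- s) \sw_(a', b' <- t) F (a * a') (b * b').
Proof.
move=> Fb; rewrite {1}(tensor_sum s) {1}(tensor_sum t) mul_sw sw_sw //.
apply: eq_sw => a b; rewrite sw_sw //; apply: eq_sw => a' b'.
by rewrite ptensorM sw_pure.
Qed.

Lemma linear_tens_map V V' W W' (f : V -> V') (g : W -> W') :
  linear f -> linear g -> linear (tens_map f g).
Proof. by move=> fl gl; rewrite /tens_map; lin. Qed.

(** Serves to bundle the inverse of [Phi], which bijectivity provides only as a bare function. *)
Lemma alg_hom_lrmorphism (A B : algType k) (f : A -> B) :
  alg_hom f -> exists g : {lrmorphism A -> B}, f = g :> (A -> B).
Proof.
case=> fl fm.
pose fL := GRing.isLinear.Build k A B *:%R f fl.
pose fM := GRing.isMonoidMorphism.Build A B f fm.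
pose g : {lrmorphism A -> B} := HB.pack f fL fM.
by exists g.
Qed.

End Sweedler.

(** * Algebra maps into and between tensor product algebras *)

Section TensorMorphisms.
Variables (k : fieldType) (A A' B B' : algType k).

Definition tens_inl (a : A) : A ⊗ B := a ⊗ 1.
Definition tens_inr (b : B) : A ⊗ B := 1 ⊗ b.

Fact tens_inl_linear : linear tens_inl.
Proof. by rewrite /tens_inl; lin. Qed.
Fact tens_inl_monoid : monoid_morphism tens_inl.
Proof. by split=> // x y; rewrite /tens_inl ptensorM mulr1. Qed.
Fact tens_inr_linear : linear tens_inr.
Proof. by rewrite /tens_inr; lin. Qed.
Fact tens_inr_monoid : monoid_morphism tens_inr.
Proof. by split=> // x y; rewrite /tens_inr ptensorM mulr1. Qed.

HB.instance Definition _ :=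
  GRing.isLinear.Build k A (tensor A B) *:%R tens_inl tens_inl_linear.
HB.instance Definition _ :=
  GRing.isMonoidMorphism.Build A (tensor A B) tens_inl tens_inl_monoid.
HB.instance Definition _ :=
  GRing.isLinear.Build k B (tensor A B) *:%R tens_inr tens_inr_linear.
HB.instance Definition _ :=
  GRing.isMonoidMorphism.Build B (tensor A B) tens_inr tens_inr_monoid.

Variables (f : {lrmorphism A -> A'}) (g : {lrmorphism B -> B'}).

Fact tens_map_linear : linear (tens_map f g).
Proof. by apply: linear_tens_map; exact: linearP. Qed.

Fact tens_map_monoid : monoid_morphism (tens_map f g).
Proof.
split=> [|s t].
  by rewrite -ptensor1 /tens_map sw_pure ?rmorph1 ?ptensor1 //; lin.
rewrite /tens_map sw_prod; last by lin.
rewrite mul_sw; apply: eq_sw => a b; apply: eq_sw => a' b'.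
by rewrite !rmorphM ptensorM.
Qed.

HB.instance Definition _ := GRing.isLinear.Build k (tensor A B) (tensor A' B')
  *:%R (tens_map f g) tens_map_linear.
HB.instance Definition _ := GRing.isMonoidMorphism.Build (tensor A B) (tensor A' B')
  (tens_map f g) tens_map_monoid.

End TensorMorphisms.

(** * Coassociativity and counit laws inside Sweedler sums *)

Section BialgebraSweedler.
Variables (k : fieldType) (A : bialgType k) (X : lmodType k).

(** A trilinear [F] factors through [A ⊗ (A ⊗ A)], where the coassociativity axiom lives. *)
Lemma sw_coassoc (a : A) (F : A -> A -> A -> X) :
  (forall x y, linear (fun z => F x y z)) ->
  (forall x z, linear (fun y => F x y z)) ->
  (forall y z, linear (fun x => F x y z)) ->
  \sw_(a12, a3 <- comul a) \sw_(a1, a2 <- comul a12) F a1 a2 a3 =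
  \sw_(a1, a23 <- comul a) \sw_(a2, a3 <- comul a23) F a1 a2 a3.
Proof.
move=> F3 F2 F1; have [_ _ coass _ _] := @bialgebraP k A.
have Fb x : bilinear_for *:%R *:%R (F x) by split=> *; [exact: F2 | exact: F3].
have Fb' : bilinear_for *:%R *:%R (fun x t => sw t (F x)).
  split=> [t|x]; last exact: sw_linear.
  by apply: linear_swr => y z; exact: F1.
have := congr1 (fun t => sw t (fun x t => sw t (F x))) (coass a).
rewrite 2?sw_sw //=; under eq_sw => u v.
  rewrite sw_sw //; under eq_sw => x y do rewrite (sw_pure Fb') (sw_pure (Fb _)).
  over.
move=> ->; apply: eq_sw => u v; rewrite sw_sw //.
by apply: eq_sw => x y; rewrite (sw_pure Fb') (sw_pure (Fb _)).
Qed.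

Lemma sw_counitl (a : A) (F : A -> X) :
  linear F -> \sw_(a1, a2 <- comul a) (counit a1 *: F a2) = F a.
Proof.
move=> Fl; have [_ _ _ cl _] := @bialgebraP k A.
rewrite -[in RHS](cl a) linear_sw //; apply: eq_sw => x y.
exact/esym/linear_homog.
Qed.

Lemma sw_counitr (a : A) (F : A -> X) :
  linear F -> \sw_(a1, a2 <- comul a) (counit a2 *: F a1) = F a.
Proof.
move=> Fl; have [_ _ _ _ cr] := @bialgebraP k A.
rewrite -[in RHS](cr a) linear_sw //; apply: eq_sw => x y.
exact/esym/linear_homog.
Qed.

End BialgebraSweedler.

(** * Factorization of [L] through the inverse [Psi] of [Phi] *)

Section Splitting.
Variables (k : fieldType) (M : algType k) (eta : {lrmorphism M -> k^o}).
Variables (L H : bialgType k) (q : {lrmorphism L -> M}) (p : {lrmorphism L -> H}).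
Variable Psi : {lrmorphism M ⊗ H -> L}.
Hypothesis eta_q : forall l, eta (q l) = counit l.
Hypothesis p_coalg : coalg_hom comul counit comul counit p.
Hypothesis PhiK : forall l, Psi (tens_map q p (comul l)) = l.
Hypothesis PsiK : forall t, tens_map q p (comul (Psi t)) = t.

Variables (m : {lrmorphism M -> L}) (c : {lrmorphism H -> L}).
Hypothesis mE : forall x, m x = Psi (x ⊗ 1).
Hypothesis cE : forall h, c h = Psi (1 ⊗ h).

Lemma incl_mul x h : Psi (x ⊗ h) = m x * c h.
Proof. by rewrite mE cE -rmorphM ptensorM mulr1 mul1r. Qed.

Lemma incl_comm x h : c h * m x = m x * c h.
Proof. by rewrite -incl_mul mE cE -rmorphM ptensorM mulr1 mul1r. Qed.

(** Both cases form one pair, so that [rewrite Phi_incl] serves either inclusion. *)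
Lemma Phi_incl :
  (forall x, tens_map q p (comul (m x)) = x ⊗ 1) *
  (forall h, tens_map q p (comul (c h)) = 1 ⊗ h).
Proof. by split=> z; rewrite (mE, cE) PsiK. Qed.

Lemma sw_Phi_l (X : lmodType k) (F : M -> H -> X) x : bilinear_for *:%R *:%R F ->
  \sw_(l1, l2 <- comul (m x)) F (q l1) (p l2) = F x 1.
Proof. by move=> Fb; rewrite -(sw_map _ _ _ Fb) Phi_incl sw_pure. Qed.

Lemma sw_Phi_r (X : lmodType k) (F : M -> H -> X) h : bilinear_for *:%R *:%R F ->
  \sw_(l1, l2 <- comul (c h)) F (q l1) (p l2) = F 1 h.
Proof. by move=> Fb; rewrite -(sw_map _ _ _ Fb) Phi_incl sw_pure. Qed.

(** Here and in the next three lemmas, a counit inserted on one leg of Δ is rewritten as [counit]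
    after [p] or [eta] after [q]; the sum is then a function of [Phi (m x)] or [Phi (c h)], which is
    known. *)
Lemma q_incl_l x : q (m x) = x.
Proof.
rewrite -(sw_counitr (m x) (F := q)); last by lin.
under eq_sw => a b do rewrite -p_coalg.2.
rewrite (sw_Phi_l (F := fun x h => (counit h : k) *: x)); last by lin.
by rewrite rmorph1 scale1r.
Qed.

Lemma p_incl_l x : p (m x) = (eta x : k) *: 1.
Proof.
rewrite -(sw_counitl (m x) (F := p)); last by lin.
under eq_sw => a b do rewrite -eta_q.
by rewrite (sw_Phi_l (F := fun x h => (eta x : k) *: h)); last by lin.
Qed.

Lemma q_incl_r h : q (c h) = (counit h : k) *: 1.
Proof.
rewrite -(sw_counitr (c h) (F := q)); last by lin.
under eq_sw => a b do rewrite -p_coalg.2.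
by rewrite (sw_Phi_r (F := fun x h => (counit h : k) *: x)); last by lin.
Qed.

Lemma p_incl_r h : p (c h) = h.
Proof.
rewrite -(sw_counitl (c h) (F := p)); last by lin.
under eq_sw => a b do rewrite -eta_q.
rewrite (sw_Phi_r (F := fun x h => (eta x : k) *: h)); last by lin.
by rewrite rmorph1 scale1r.
Qed.

Lemma conv_incl l : \sw_(l1, l2 <- comul l) (m (q l1) * c (p l2)) = l.
Proof.
rewrite -[RHS]PhiK (linear_sw (h := Psi)); last by lin.
by apply: eq_sw => a b; rewrite incl_mul.
Qed.

(* [Phi] is a morphism of right [H]-comodules, because [p] is a coalgebra map. *)
Lemma sw_colinear (X : lmodType k) (F : L -> H -> X) l :
  bilinear_for *:%R *:%R F ->
  \sw_(l1, l2 <- comul l) F l1 (p l2) =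
  \sw_(x, h <- tens_map q p (comul l)) \sw_(h1, h2 <- comul h) F (m x * c h1) h2.
Proof.
move=> Fb; rewrite sw_map; last by lin.
(* The first leg is factored by [conv_incl]; coassociativity then pairs [p l2] with [p l3], and
   together they form Δ of [p] of the second leg. *)
transitivity (\sw_(l12, l3 <- comul l) \sw_(l1, l2 <- comul l12)
    F (m (q l1) * c (p l2)) (p l3)).
  apply: eq_sw => a b; rewrite -{1}[a]conv_incl.
  by rewrite (linear_sw (h := F^~ (p b))); last by lin.
rewrite sw_coassoc; [|lin..].
by apply: eq_sw => a b; rewrite -p_coalg.1 sw_map; last by lin.
Qed.

Lemma sw_coinv (X : lmodType k) (F : L -> H -> X) x :
  bilinear_for *:%R *:%R F ->
  \sw_(l1, l2 <- comul (m x)) F l1 (p l2) = F (m x) 1.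
Proof.
move=> Fb; rewrite sw_colinear // Phi_incl sw_pure; last by lin.
rewrite rmorph1 -ptensor1 sw_pure; last by lin.
by rewrite rmorph1 mulr1.
Qed.

Lemma sw_incl_r_colinear (X : lmodType k) (F : L -> H -> X) h :
  bilinear_for *:%R *:%R F ->
  \sw_(l1, l2 <- comul (c h)) F l1 (p l2) =
  \sw_(h1, h2 <- comul h) F (c h1) h2.
Proof.
move=> Fb; rewrite sw_colinear // Phi_incl sw_pure; last by lin.
by apply: eq_sw => a b; rewrite rmorph1 mul1r.
Qed.

(** The second leg is factored by [conv_incl]. The bracketing leaves [p l3] outermost, where the
    colinearity lemmas can evaluate it. *)
Lemma sw_conv (X : lmodType k) (G : L -> L -> X) l :
  bilinear_for *:%R *:%R G ->
  sw (comul l) G =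
  \sw_(l12, l3 <- comul l) \sw_(l1, l2 <- comul l12) G l1 (m (q l2) * c (p l3)).
Proof.
move=> Gb; rewrite sw_coassoc; [|lin..].
apply: eq_sw => a b; rewrite -{1}[b]conv_incl.
by rewrite (linear_sw (h := G a)); last by lin.
Qed.

Lemma sw_comul_l (X : lmodType k) (G : L -> L -> X) x :
  bilinear_for *:%R *:%R G ->
  sw (comul (m x)) G = \sw_(l1, l2 <- comul (m x)) G l1 (m (q l2)).
Proof.
move=> Gb; rewrite sw_conv //.
(* Coinvariance of [m x] puts 1 in place of [p l3]. *)
rewrite (sw_coinv (F := fun l h => \sw_(l1, l2 <- comul l) G l1 (m (q l2) * c h)));
  last by lin.
by apply: eq_sw => a b; rewrite rmorph1 mulr1.
Qed.

Lemma sw_comul_r (X : lmodType k) (G : L -> L -> X) h :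
  bilinear_for *:%R *:%R G ->
  sw (comul (c h)) G =
  \sw_(h12, h3 <- comul h) \sw_(l1, l2 <- comul (c h12)) G l1 (m (q l2) * c h3).
Proof.
move=> Gb; rewrite sw_conv //.
by rewrite (sw_incl_r_colinear
  (F := fun l h => \sw_(l1, l2 <- comul l) G l1 (m (q l2) * c h))); last by lin.
Qed.

(** * The structure maps read off from Δ of [L], and the axioms of a pair *)

Definition split_nabla : {lrmorphism M -> H ⊗ M} := tens_map p q \o comul \o m.
Definition split_btri : {lrmorphism H -> H ⊗ M} := tens_map p q \o comul \o c.
Definition split_delta : {lrmorphism M -> M ⊗ M} := tens_map q q \o comul \o m.
Definition split_sigma : {lrmorphism H -> M ⊗ M} := tens_map q q \o comul \o c.

(** This and the next four identities are counit laws of [L], since [counit] after [p] and [eta]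
    after [q] both equal the counit of [L]; the values of [p] and [q] on [m] and [c] finish them. *)
Lemma split_nabla_counit x :
  \sw_(xm, x0 <- split_nabla x) ((counit xm : k) *: x0) = x.
Proof.
rewrite sw_map; last by lin.
under eq_sw => a b do rewrite p_coalg.2.
by rewrite sw_counitl ?q_incl_l //; lin.
Qed.

Lemma split_btri_eta h : \sw_(h0, h1 <- split_btri h) ((eta h1 : k) *: h0) = h.
Proof.
rewrite sw_map; last by lin.
under eq_sw => a b do rewrite eta_q.
by rewrite sw_counitr ?p_incl_r //; lin.
Qed.

Lemma split_nabla_eta x :
  \sw_(xm, x0 <- split_nabla x) ((eta x0 : k) *: xm) = (eta x : k) *: 1.
Proof.
rewrite sw_map; last by lin.
under eq_sw => a b do rewrite eta_q.
by rewrite sw_counitr ?p_incl_l //; lin.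
Qed.

Lemma split_btri_counit h :
  \sw_(h0, h1 <- split_btri h) ((counit h0 : k) *: h1) = (counit h : k) *: 1.
Proof.
rewrite sw_map; last by lin.
under eq_sw => a b do rewrite p_coalg.2.
by rewrite sw_counitl ?q_incl_r //; lin.
Qed.

Lemma split_sigma_eta h :
  \sw_(s1, s2 <- split_sigma h) (eta s1 * eta s2) = counit h.
Proof.
rewrite sw_map; last by lin.
under eq_sw => a b do rewrite !eta_q.
(* In [k^o] the product [counit a * counit b] is also the scaling of [counit b] by [counit a]. *)
rewrite (sw_counitl _ (F := counit)); last by lin.
by rewrite -p_coalg.2 p_incl_r.
Qed.

Definition split_pair : cocycle_pair eta H :=
  @CocyclePair k M eta H split_nabla split_btri split_delta split_sigma
    split_nabla_counit split_btri_eta split_nabla_eta split_btri_counit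
    split_sigma_eta.

(** On the right, [sw_comul_l] read backwards replaces [m (q l2)] by [l2]. After coassociativity the
    first two legs recombine by [conv_incl], which leaves [sw_comul_l] for the tensor itself. *)
Lemma comul_incl_l x :
  comul (m x) =
  \sw_(x1, x2 <- split_delta x) \sw_(x2m, x20 <- split_nabla x2)
    ((m x1 * c x2m) ⊗ m x20).
Proof.
rewrite sw_map; last by lin.
transitivity (\sw_(l1, l2 <- comul (m x)) \sw_(l21, l22 <- comul (m (q l2)))
    ((m (q l1) * c (p l21)) ⊗ m (q l22))); last first.
  by apply: eq_sw => a b; rewrite sw_map; last by lin.
rewrite -(sw_comul_l (G := fun l1 l2 => \sw_(l21, l22 <- comul l2)
    ((m (q l1) * c (p l21)) ⊗ m (q l22)))); last by lin.
rewrite -sw_coassoc; [|lin..].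
rewrite [LHS]tensor_sum [LHS]sw_comul_l; last by lin.
apply: eq_sw => a b; rewrite -{1}[a]conv_incl.
by rewrite (linear_sw (h := fun l => l ⊗ m (q b))); last by lin.
Qed.

Lemma comul_incl_r h :
  comul (c h) =
  \sw_(h12, h3 <- comul h) \sw_(h1, h2 <- comul h12)
  \sw_(s1, s2 <- split_sigma h1) \sw_(s2m, s20 <- split_nabla s2)
  \sw_(b0, b1 <- split_btri h2)
    ((m s1 * c s2m * c b0) ⊗ (m s20 * m b1 * c h3)).
Proof.
rewrite [LHS]tensor_sum [LHS]sw_comul_r; last by lin.
apply: eq_sw => g z.
(* Multiplicativity of Δ merges [nabla] of [q l2] and [btri] of [h2] into Δ of the single element
   [m (q l2) * c h2]. *)
transitivity (\sw_(h1, h2 <- comul g) \sw_(l1, l2 <- comul (c h1))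
    \sw_(a, b <- comul (m (q l2) * c h2))
      ((m (q l1) * c (p a)) ⊗ (m (q b) * c z))); last first.
  apply: eq_sw => h1 h2; rewrite sw_map; last by lin.
  apply: eq_sw => l1 l2; rewrite sw_map; last by lin.
  rewrite rmorphM sw_prod; last by lin.
  apply: eq_sw => a b; rewrite sw_map; last by lin.
  by apply: eq_sw => a' b'; rewrite !rmorphM !mulrA.
(* Read backwards, [sw_comul_r] recognizes [m (q l2) * c h2] as the second leg of Δ of [c g]; the
   rest is as for [m x]. *)
rewrite -(sw_comul_r (G := fun l1 l2 => \sw_(a, b <- comul l2)
    ((m (q l1) * c (p a)) ⊗ (m (q b) * c z)))); last by lin.
rewrite -sw_coassoc; [|lin..].
apply: eq_sw => a b; rewrite -{1}[a]conv_incl.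
by rewrite (linear_sw (h := fun l => l ⊗ (m (q b) * c z))); last by lin.
Qed.

Lemma split_formulas : comul_formulas split_pair Psi.
Proof.
split=> [x|h].
  rewrite -mE comul_incl_l; apply: eq_sw => x1 x2; apply: eq_sw => x2m x20.
  by rewrite !(mE, cE).
rewrite -cE comul_incl_r; do 5!(apply: eq_sw => ? ?).
by rewrite !(mE, cE).
Qed.

(** * Consequences of the coproduct formulas: uniqueness of the structure maps and compatibility of
    [Psi] with the coproducts *)

Section Formulas.
Variable P : cocycle_pair eta H.
Hypothesis PP : comul_formulas P Psi.

Lemma sw_formula_l (X : lmodType k) (F : L -> L -> X) x :
  bilinear_for *:%R *:%R F ->
  sw (comul (m x)) F =
  \sw_(x1, x2 <- delta P x) \sw_(x2m, x20 <- nabla P x2)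
    F (m x1 * c x2m) (m x20).
Proof.
move=> Fb; rewrite mE (PP.1 x) sw_sw //; apply: eq_sw => x1 x2.
by rewrite sw_sw //; apply: eq_sw => x2m x20; rewrite sw_pure // !(mE, cE).
Qed.

Lemma sw_formula_r (X : lmodType k) (F : L -> L -> X) h :
  bilinear_for *:%R *:%R F ->
  sw (comul (c h)) F =
  \sw_(h12, h3 <- comul h) \sw_(h1, h2 <- comul h12)
  \sw_(s1, s2 <- sigma P h1) \sw_(s2m, s20 <- nabla P s2)
  \sw_(b0, b1 <- btri P h2)
    F (m s1 * c s2m * c b0) (m s20 * m b1 * c h3).
Proof.
move=> Fb; rewrite cE (PP.2 h) sw_sw //; apply: eq_sw => h12 h3.
rewrite sw_sw //; apply: eq_sw => h1 h2.
rewrite sw_sw //; apply: eq_sw => s1 s2.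
rewrite sw_sw //; apply: eq_sw => s2m s20.
by rewrite sw_sw //; apply: eq_sw => b0 b1; rewrite sw_pure // !(mE, cE).
Qed.

(** Under [q ⊗ q], the factor [c x2m] of the formula becomes the scalar [counit x2m], which
    [nabla_counit] absorbs. *)
Lemma delta_uniq : delta P =1 split_delta.
Proof.
move=> x; rewrite [RHS]sw_formula_l; last by lin.
rewrite [LHS]tensor_sum; apply: eq_sw => x1 x2.
rewrite -{1}[x2](nabla_counit P) (linear_sw (h := fun t => x1 ⊗ t)); last by lin.
apply: eq_sw => x2m x20.
by rewrite rmorphM /= !q_incl_l q_incl_r -scalerAr mulr1 ptensorZl ptensorZr.
Qed.

Lemma sigma_uniq : sigma P =1 split_sigma.
Proof.
move=> h; rewrite [RHS]sw_formula_r; last by lin.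
rewrite -[LHS](sw_counitr h (F := sigma P)); last by lin.
apply: eq_sw => h12 h3.
rewrite -(sw_counitr h12 (F := sigma P)); last by lin.
rewrite (linear_sw (h := fun t => (counit h3 : k) *: t)); last by lin.
apply: eq_sw => h1 h2.
rewrite {1}[sigma P h1]tensor_sum.
rewrite (linear_sw (h := fun t => (counit h3 : k) *: ((counit h2 : k) *: t)));
  last by lin.
apply: eq_sw => s1 s2.
rewrite -{1}[s2](nabla_counit P).
rewrite (linear_sw
  (h := fun t => (counit h3 : k) *: ((counit h2 : k) *: (s1 ⊗ t)))); last by lin.
apply: eq_sw => s2m s20.
rewrite -!ptensorZr.
(* The scalar [counit h2] becomes a factor [counit h2 *: 1], the right side of [btri_counit], so
   that the sum over [btri P h2] can be introduced. *)
have -> : (counit h2 : k) *: ((counit s2m : k) *: s20) =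
    ((counit s2m : k) *: s20) * ((counit h2 : k) *: 1) by rewrite -scalerAr mulr1.
rewrite -(btri_counit P).
rewrite (linear_sw (h := fun t =>
  s1 ⊗ ((counit h3 : k) *: (((counit s2m : k) *: s20) * t)))); last by lin.
apply: eq_sw => b0 b1.
rewrite !rmorphM /= !q_incl_l !q_incl_r.
rewrite -!scalerAr -!scalerAl !mulr1 !ptensorZl !ptensorZr !scalerA.
by rewrite -[in LHS]mulrA mulrC.
Qed.

Lemma nabla_uniq : nabla P =1 split_nabla.
Proof.
move=> x; rewrite [RHS]sw_formula_l; last by lin.
(* That [eta] on the first leg of [delta P x] returns [x] comes from [delta_uniq] and the counit law
   of [L]. *)
transitivity (nabla P (\sw_(x1, x2 <- delta P x) ((eta x1 : k) *: x2))).
  rewrite delta_uniq sw_map; last by lin.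
  under eq_sw => a b do rewrite eta_q.
  by rewrite sw_counitl ?q_incl_l //; lin.
rewrite (linear_sw (h := nabla P)); last by lin.
apply: eq_sw => x1 x2; rewrite linearZ /= {1}[nabla P x2]tensor_sum.
rewrite (linear_sw (h := fun t => (eta x1 : k) *: t)); last by lin.
apply: eq_sw => x2m x20.
by rewrite rmorphM /= p_incl_l p_incl_r q_incl_l -scalerAl mul1r ptensorZl.
Qed.

Lemma btri_uniq : btri P =1 split_btri.
Proof.
move=> h; rewrite [RHS]sw_formula_r; last by lin.
rewrite -[LHS](sw_counitr h (F := btri P)); last by lin.
apply: eq_sw => h12 h3.
rewrite -(sw_counitl h12 (F := btri P)); last by lin.
rewrite (linear_sw (h := fun t => (counit h3 : k) *: t)); last by lin.
apply: eq_sw => h1 h2.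
(* By [sigma_uniq] and the counit law of [L], [eta] on the first leg of [sigma P h1] gives
   [counit h1 *: 1], which [nabla P] sends to [counit h1 *: 1]. *)
have -> : (counit h1 : k) *: btri P h2 =
    \sw_(s1, s2 <- sigma P h1) ((eta s1 : k) *: (nabla P s2 * btri P h2)).
  rewrite sigma_uniq sw_map; last by lin.
  under eq_sw => a b do rewrite eta_q.
  rewrite (sw_counitl _ (F := fun l => nabla P (q l) * btri P h2)); last by lin.
  by rewrite q_incl_r linearZ /= rmorph1 -scalerAl mul1r.
rewrite (linear_sw (h := fun t => (counit h3 : k) *: t)); last by lin.
apply: eq_sw => s1 s2; rewrite {1}[nabla P s2]tensor_sum {1}[btri P h2]tensor_sum.
rewrite mul_sw (linear_sw (h := fun t => (counit h3 : k) *: ((eta s1 : k) *: t)));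
  last by lin.
apply: eq_sw => s2m s20.
rewrite (linear_sw (h := fun t => (counit h3 : k) *: ((eta s1 : k) *: t))); last by lin.
apply: eq_sw => b0 b1.
rewrite !rmorphM /= !q_incl_l !q_incl_r !p_incl_r p_incl_l ptensorM.
by rewrite -!scalerAr -!scalerAl mulr1 mul1r ptensorZl ptensorZr scalerA mulrC -scalerA.
Qed.

Lemma tens_map_ccdc_comul t :
  tens_map Psi Psi (ccdc_comul P t) = comul (Psi t).
Proof.
have lm : linear (tens_map Psi Psi) by exact: linearP.
have lc : linear (ccdc_comul P) by rewrite /ccdc_comul; lin.
move: t; apply: tensor_lin_ext => [||x h]; [lin|lin|].
(* On a pure tensor, Δ of [m x * c h] is the product of the two formulas, to be matched sum by
   sum. *)
rewrite incl_mul rmorphM /= mE cE (PP.1 x) (PP.2 h) sw_mull.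
rewrite /ccdc_comul sw_pure; last by lin.
rewrite linear_sw //; apply: eq_sw => x1 x2.
rewrite linear_sw // sw_mull; apply: eq_sw => x2m x20.
rewrite linear_sw // sw_mulr; apply: eq_sw => h12 h3.
rewrite linear_sw // sw_mulr; apply: eq_sw => h1 h2.
rewrite linear_sw // sw_mulr; apply: eq_sw => s1 s2.
rewrite linear_sw // sw_mulr; apply: eq_sw => s2m s20.
rewrite linear_sw // sw_mulr; apply: eq_sw => b0 b1.
rewrite /tens_map sw_pure; last by lin.
rewrite -!mE -!cE ptensorM !incl_mul !rmorphM /=; congr (_ ⊗ _);
  last by rewrite !mulrA.
(* In the first leg [m s1] has to move past [c x2m]. *)
by rewrite -!mulrA [c x2m * (m s1 * _)]mulrA incl_comm -!mulrA.
Qed.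

End Formulas.
End Splitting.

(** * Transport of a bialgebra structure along an algebra isomorphism *)

Section Transport.
Variables (k : fieldType) (A : bialgType k) (B : algType k).
Variables (Phi : {lrmorphism A -> B}) (Psi : {lrmorphism B -> A}).
Hypotheses (PhiK : cancel Phi Psi) (PsiK : cancel Psi Phi).
Variables (D : B -> B ⊗ B) (e : B -> k^o).
Hypothesis comulE : forall b, tens_map Psi Psi (D b) = comul (Psi b).
Hypothesis counitE : forall b, e b = counit (Psi b).

Lemma transport_comul b : D b = tens_map Phi Phi (comul (Psi b)).
Proof.
rewrite -comulE [RHS]sw_map; last by lin.
by rewrite [LHS]tensor_sum; apply: eq_sw => x y; rewrite !PsiK.
Qed.

(** [D] and [e] are the conjugates of [comul] and [counit], so each axiom reduces to that of [A]
    once [Phi] and [Psi] cancel. *)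
Lemma transport_bialgebra : bialgebra_axioms D e.
Proof.
have -> : D = tens_map Phi Phi \o comul \o Psi.
  by apply: funext => b; exact: transport_comul.
have -> : e = counit \o Psi by apply: funext => b; exact: counitE.
split.
- by split; [exact: linearP | split; [exact: rmorph1 | exact: rmorphM]].
- by split; [exact: linearP | split; [exact: rmorph1 | exact: rmorphM]].
- move=> b /=.
  rewrite sw_map; last by lin.
  rewrite [RHS]sw_map; last by lin.
  under eq_sw => x y. rewrite PhiK sw_map; last by lin. over.
  under [RHS]eq_sw => x y. rewrite PhiK sw_map; last by lin. over.
  by rewrite sw_coassoc; [|lin..].
- move=> b /=; rewrite sw_map; last by lin.
  under eq_sw => x y do rewrite PhiK.
  by rewrite sw_counitl ?PsiK //; lin.
- move=> b /=; rewrite sw_map; last by lin.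
  under eq_sw => x y do rewrite PhiK.
  by rewrite sw_counitr ?PsiK //; lin.
Qed.

Lemma transport_coalg_hom : coalg_hom comul counit D e Phi.
Proof. by split=> a; rewrite ?transport_comul ?counitE PhiK. Qed.

End Transport.

(** Identifying [L] with [M ⊗ H] is expressed by quantifying over the inverses [Psi] of [Phi]; the
    last clause states that the formulas determine the four structure maps. *)
Theorem proposition3p4 (k : fieldType) (M : algType k)
    (eta : {lrmorphism M -> k^o}) (L H : bialgType k)
    (q : {lrmorphism L -> M}) (p : {lrmorphism L -> H}) :
  (forall y : M, exists l, q l = y) ->
  (forall h : H, exists l, p l = h) ->
  (forall l, eta (q l) = counit l) ->
  coalg_hom comul counit comul counit p ->
  let Phi : L -> M ⊗ H := fun l => tens_map q p (comul l) in
  alg_iso Phi ->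
  exists P : cocycle_pair eta H,
    [/\ bialgebra_axioms (ccdc_comul P) (@ccdc_counit k M eta H),
        alg_iso Phi /\
          coalg_hom comul counit (ccdc_comul P) (@ccdc_counit k M eta H) Phi,
        forall Psi : M ⊗ H -> L, cancel Phi Psi -> cancel Psi Phi ->
          comul_formulas P Psi &
        forall (P' : cocycle_pair eta H) (Psi : M ⊗ H -> L),
          cancel Phi Psi -> cancel Psi Phi -> comul_formulas P' Psi ->
          [/\ nabla P' =1 nabla P, btri P' =1 btri P,
              delta P' =1 delta P & sigma P' =1 sigma P]].
Proof.
move=> _ _ eta_q p_coalg Phi PhiI; have [Phi_hom [Psi0 PhiK PsiK]] := PhiI.
pose F : {lrmorphism L -> M ⊗ H} := tens_map q p \o comul.
have Psi_hom : alg_hom Psi0.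
  by split; [exact: (can2_linear (f := F)) | exact: (can2_monoid_morphism (f := F))].
have [Psi PsiE] := alg_hom_lrmorphism Psi_hom.
(* Inverses are unique, so claims about an arbitrary inverse reduce to the bundled [Psi]. *)
have PsiU Psi' : cancel Phi Psi' -> Psi' = Psi.
  by move=> PhiK'; rewrite -PsiE; apply: funext => t; rewrite -[t in LHS]PsiK PhiK'.
rewrite PsiE in PhiK PsiK.
pose m : {lrmorphism M -> L} := Psi \o @tens_inl k M H.
pose c : {lrmorphism H -> L} := Psi \o @tens_inr k M H.
have mE x : m x = Psi (x ⊗ 1) by [].
have cE h : c h = Psi (1 ⊗ h) by [].
pose P := split_pair eta_q p_coalg PsiK mE cE.
have PP : comul_formulas P Psi := split_formulas eta_q p_coalg PhiK PsiK mE cE.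
have comulE t : tens_map Psi Psi (ccdc_comul P t) = comul (Psi t).
  exact: (tens_map_ccdc_comul mE cE PP).
have counitE t : ccdc_counit eta t = counit (Psi t).
  (* With [t] written as [Phi l], the left side is the sum of [counit l1 * counit l2], that is
     [counit l]. *)
  rewrite -[in LHS](PsiK t) /ccdc_counit sw_map; last by lin.
  under eq_sw => a b do rewrite eta_q p_coalg.2.
  by rewrite (sw_counitl _ (F := counit)) //; lin.
exists P; split.
- exact: (@transport_bialgebra k L _ F Psi PhiK PsiK).
- by split=> //; exact: (@transport_coalg_hom k L _ F Psi PhiK PsiK).
- by move=> Psi' /PsiU ->.
- move=> P' Psi' /PsiU -> _ PP'; split.
  + exact: (nabla_uniq eta_q p_coalg PsiK mE cE PP').
  + exact: (btri_uniq eta_q p_coalg PsiK mE cE PP').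
  + exact: (delta_uniq p_coalg PsiK mE cE PP').
  + exact: (sigma_uniq p_coalg PsiK mE cE PP').
Qed.
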